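(* For all integers $d\ge2$ and $k\ge2$, \[ m(d,k)\ge L_{\mathrm{bin}}(d,k)=k+\max_{2\le r\le\min(d,k)}\binom{k}{r}. \] In particular, for $k\ge4$ and $d\ge\lfloor k/2\rfloor$, \[ m(d,k)\ge k+\binom{k}{\lfloor k/2\rfloor}. \]
   Context: A $k$-component Gaussian mixture density on $\mathbb{R}^d$ is a function $\Phi(x)=\sum_{i=1}^k\alpha_i\phi_i(x)$, where $\alpha_i>0$, $\sum_{i=1}^k\alpha_i=1$, and $\phi_i(x)=(2\pi)^{-d/2}\det(\Sigma_i)^{-1/2}\exp\left(-\frac12(x-\mu_i)^\top\Sigma_i^{-1}(x-\mu_i)\right)$ with $\mu_i\in\mathbb{R}^d$ and each $\Sigma_i$ a (symmetric) positive definite $d\times d$ matrix. $\mathrm{Mode}(\Phi)$ is the set of all (not necessarily strict) local maximum points of $\Phi$: $x\in\mathrm{Mode}(\Phi)$ iff there is $\rho>0$ with $\Phi(y)\le\Phi(x)$ whenever $\|y-x\|<\rho$. $m(d,k)$ denotes the supremum of $|\mathrm{Mode}(\Phi)|$ over all $k$-component Gaussian mixture densities $\Phi$ on $\mathbb{R}^d$ for which $\mathrm{Mode}(\Phi)$ is finite. *)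

(* Defs.v *)
From HB Require Import structures.
From mathcomp Require Import all_boot all_order all_algebra.
From mathcomp Require Import finmap.
From mathcomp Require Import all_classical all_reals all_analysis.

Set Implicit Arguments.
Unset Strict Implicit.
Unset Printing Implicit Defensive.

Import Order.TTheory GRing.Theory Num.Theory.

Local Open Scope classical_set_scope.
Local Open Scope ring_scope.

(* The norm that the library puts on 'cV[R]_d is the sup norm. *)
Definition euclidean_norm (R : realType) (d : nat) (x : 'cV[R]_d) : R :=
  Num.sqrt (\sum_(i < d) x i 0 ^+ 2).

Definition posdefmx (R : realType) (d : nat) (S : 'M[R]_d) : Prop :=
  S^T = S /\ forall v : 'cV[R]_d, v != 0 -> 0 < (v^T *m S *m v) 0 0.

Definition gaussian_density (R : realType) (d : nat)
    (mu : 'cV[R]_d) (S : 'M[R]_d) (x : 'cV[R]_d) : R :=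
  (2 * pi) `^ (- (d%:R / 2)) * (\det S) `^ (- (1 / 2))
  * expR (- (1 / 2) * ((x - mu)^T *m invmx S *m (x - mu)) 0 0).

(* The components need not be pairwise distinct. *)
Definition is_gaussian_mixture (R : realType) (d k : nat)
    (Phi : 'cV[R]_d -> R) : Prop :=
  exists (alpha : 'I_k -> R) (mu : 'I_k -> 'cV[R]_d) (S : 'I_k -> 'M[R]_d),
    [/\ forall i, 0 < alpha i,
        \sum_(i < k) alpha i = 1,
        forall i, posdefmx (S i)
      & forall x, Phi x = \sum_(i < k) alpha i * gaussian_density (mu i) (S i) x].

Definition modes (R : realType) (d : nat) (Phi : 'cV[R]_d -> R) :
    set 'cV[R]_d :=
  [set x | exists2 rho : R, 0 < rho &
     forall y, euclidean_norm (y - x) < rho -> Phi y <= Phi x].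

(* The supremum is taken in the extended reals, so that no bound on the number
   of modes is presupposed. *)
Definition max_modes (R : realType) (d k : nat) : \bar R :=
  ereal_sup [set (#|` fset_set (modes Phi)|%:R)%:E | Phi in
    [set Phi : 'cV[R]_d -> R |
       is_gaussian_mixture k Phi /\ finite_set (modes Phi)]].

Definition L_bin (d k : nat) : nat :=
  (k + \max_(2 <= r < (minn d k).+1) 'C(k, r))%N.

(* Main.v *)
Require Import Defs.
From mathcomp Require Import all_boot all_order all_algebra.
From mathcomp Require Import ring lra.
From mathcomp Require Import all_classical all_reals all_analysis.

Set Implicit Arguments.
Unset Strict Implicit.
Unset Printing Implicit Defensive.

Import Order.TTheory GRing.Theory Num.Theory.
Import numFieldNormedType.Exports.

Local Open Scope ring_scope.

(** Why the theorem is true.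

    Everything reduces to one construction: for 2 <= r <= min(d, k), a
    k-component mixture on R^d with finitely many modes and at least
    k + C(k, r) of them.

    The landscape.  Identify x in R^d with the monic polynomial of degree d
    whose lower coefficients are the coordinates of x.  For a number t, the
    polynomials vanishing at t form an affine hyperplane ([value t x = 0]), and
    d hyperplanes with distinct t meet in exactly one point, because a monic
    polynomial of degree d with d prescribed roots is unique.  Component i is a
    ridge of height 1, steep (parameter kappa) across the hyperplanes t = i and
    t = k, ..., k + d - r - 1, and nearly flat (parameter delta) in the other
    directions.  The hyperplanes t >= k are common to all the components and cut
    the dimension down from d to r.  When r ridges meet, the sum is close to r
    at the meeting point, while on a small cube around it each point is off one
    of the r ridges and the sum is at most r - 1 plus a small error.  Around the
    centre of a single ridge the other ridges are negligible and the weak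
    curvature delta suffices.  So each of the C(k, r) crossings and of the k
    centres beats the boundary of a cube by a uniform margin
    ([landscape_peaks]), hence yields a mode by compactness ([interior_mode]),
    and this survives every small perturbation.

    Finiteness.  Multiplying a Gaussian sum by exp(a.x) changes the means and
    the weights only, so up to a factor the result is still a mixture
    ([tilted_mixture]).  A mode x of the tilted sum satisfies score(x) = a,
    where the score is minus the gradient of the logarithm of the untilted sum
    ([mode_score]), and such x stay in a fixed cube ([score_bounded]).  By
    Sard's theorem for the score, arbitrarily small tilts a have a finite
    fibre.

    Sard by counting ([quantitative_sard]).  The derivative of the score is
    symmetric.  Cut the cube into N^d cells and take N^(2d) candidate values a
    on a grid.  If every candidate had two preimages x, y in one cell, then with
    h = y - x the derivative D at x would satisfy D h = O(|h|^2); by symmetry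
    h.(D v) = (D h).v = O(|h|^2 |v|) for every v, so the image of the cell would lie in a slab
    of thickness O(N^-2) and diameter O(N^-1), which contains only O(N^(d-1))
    grid points.  This gives N^(2d) <= O(N^(2d-1)), false for large N.  So for
    some a each cell holds at most one preimage.

    The differential calculus needed is elementary: [c11 f g] records that f is
    bounded, Lipschitz and has gradient g with a quadratic remainder on every
    cube, and the class is closed under sums, products, exponentials and
    inverses. *)

(** * Functions with a quadratic Taylor remainder *)

Section C11.
Variables (R : realType) (d : nat).
Implicit Types (x y h u v : 'cV[R]_d) (f : 'cV[R]_d -> R).
Implicit Types (g : 'cV[R]_d -> 'cV[R]_d).

Definition dot u v : R := (u^T *m v) 0 0.

Lemma dotE u v : dot u v = \sum_j u j 0 * v j 0.
Proof. by rewrite /dot mxE; apply: eq_bigr => j _; rewrite mxE. Qed.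

Lemma dotC u v : dot u v = dot v u.
Proof. by rewrite !dotE; apply: eq_bigr => j _; rewrite mulrC. Qed.

Lemma dotDl u v h : dot (u + v) h = dot u h + dot v h.
Proof. by rewrite /dot linearD mulmxDl mxE. Qed.

Lemma dotZl c u h : dot (c *: u) h = c * dot u h.
Proof. by rewrite /dot linearZ -scalemxAl mxE. Qed.

Lemma dotNl u h : dot (- u) h = - dot u h.
Proof. by rewrite -scaleN1r dotZl mulN1r. Qed.

Lemma dot0l h : dot 0 h = 0.
Proof. by rewrite /dot trmx0 mul0mx mxE. Qed.

Lemma dotDr u v h : dot h (u + v) = dot h u + dot h v.
Proof. by rewrite dotC dotDl !(dotC h). Qed.

Lemma dotZr c u h : dot h (c *: u) = c * dot h u.
Proof. by rewrite dotC dotZl (dotC h). Qed.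

Lemma dotNr u h : dot h (- u) = - dot h u.
Proof. by rewrite dotC dotNl dotC. Qed.

Lemma dot_sym (P : 'M[R]_d) u v : P^T = P -> dot u (P *m v) = dot (P *m u) v.
Proof. by move=> sP; rewrite /dot trmx_mul sP mulmxA. Qed.

Lemma dot_delta j v : dot (delta_mx j 0) v = v j 0.
Proof.
rewrite dotE (bigD1 j)//= big1 ?addr0 => [|i ij].
  by rewrite mxE !eqxx mul1r.
by rewrite mxE (negbTE ij) mul0r.
Qed.

Lemma dot_row (P : 'M[R]_d) j v : dot ((row j P)^T) v = (P *m v) j 0.
Proof. by rewrite /dot trmxK -row_mul mxE. Qed.

Lemma dot_ge0 v : 0 <= dot v v.
Proof. by rewrite dotE sumr_ge0// => j _; rewrite -expr2 sqr_ge0. Qed.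

Lemma dotBr u v h : dot h (u - v) = dot h u - dot h v.
Proof. by rewrite dotDr dotNr. Qed.

Lemma dot_sumr (I : finType) (F : I -> 'cV[R]_d) h :
  dot h (\sum_i F i) = \sum_i dot h (F i).
Proof. by rewrite /dot mulmx_sumr summxE. Qed.

Definition box (s : R) h := forall j, `|h j 0| <= s.

Lemma box_le s s' h : s <= s' -> box s h -> box s' h.
Proof. by move=> ss' hs j; rewrite (le_trans (hs j)). Qed.

Lemma boxB s s' x y : box s x -> box s' y -> box (s + s') (x - y).
Proof. by move=> hx hy j; rewrite !mxE (le_trans (ler_normB _ _))// lerD. Qed.

Lemma boxN s h : box s h -> box s (- h).
Proof. by move=> hs j; rewrite mxE normrN. Qed.

Lemma boxBB s x : 0 <= s -> box s (x - x).
Proof. by move=> s0 j; rewrite subrr mxE normr0. Qed.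

Lemma dot_box s s' u v : box s u -> box s' v -> `|dot u v| <= d%:R * (s * s').
Proof.
move=> hu hv; rewrite dotE (le_trans (ler_norm_sum _ _ _))//.
have -> : d%:R * (s * s') = \sum_(j < d) (s * s').
  by rewrite sumr_const card_ord mulr_natl.
by apply: ler_sum => j _; rewrite normrM ler_pM.
Qed.

(** The quadratic remainder replaces the limit in the definition of the gradient:
    the counting argument needs a bound that is uniform on a cube. *)
Definition c11 f g := forall B, exists C, forall x y (s : R),
  box B x -> box B y -> 0 <= s -> box s (y - x) ->
  [/\ `|f x| <= C, `|f y - f x| <= C * s
    & `|f y - f x - dot (g x) (y - x)| <= C * s ^+ 2].

(** A nonnegative constant makes the bounds multiply. *)
Lemma c11_ge0 f g B : c11 f g -> exists2 C, 0 <= C & forall x y (s : R),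
  box B x -> box B y -> 0 <= s -> box s (y - x) ->
  [/\ `|f x| <= C, `|f y - f x| <= C * s
    & `|f y - f x - dot (g x) (y - x)| <= C * s ^+ 2].
Proof.
move=> /(_ B)[C HC]; exists (Num.max C 0); first by rewrite le_max lexx orbT.
move=> x y s xB yB s0 hs; have [h1 h2 h3] := HC x y s xB yB s0 hs.
have CC : C <= Num.max C 0 by rewrite le_max lexx.
split; first exact: le_trans h1 CC.
- by rewrite (le_trans h2)// ler_wpM2r.
- by rewrite (le_trans h3)// ler_wpM2r// exprn_ge0.
Qed.

Lemma c11_eqgrad f g g' : (forall x, g x = g' x) -> c11 f g -> c11 f g'.
Proof. by move=> /funext ->. Qed.

Lemma c11_eqfun f f' g : (forall x, f x = f' x) -> c11 f g -> c11 f' g.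
Proof. by move=> /funext ->. Qed.

Lemma c11_cst c : c11 (fun=> c) (fun=> 0).
Proof.
move=> B; exists `|c| => x y s _ _ s0 _.
by rewrite subrr dot0l subr0 normr0; split=> //; rewrite mulr_ge0// exprn_ge0.
Qed.

Lemma c11_dot u : c11 (fun x => dot u x) (fun=> u).
Proof.
move=> B; pose M := \sum_j `|u j 0|.
have M0 : 0 <= M by apply: sumr_ge0.
have hM : box M u.
  by move=> j; rewrite /M (bigD1 j)//= lerDl sumr_ge0.
exists (d%:R * (M * Num.max B 1)) => x y s xB yB s0 hs.
have B1 : 1 <= Num.max B 1 by rewrite le_max lexx orbT.
have d0 : 0 <= d%:R :> R by [].
split.
- by rewrite dot_box// => j; rewrite (le_trans (xB j))// le_max lexx.
- rewrite -dotBr (le_trans (dot_box hM hs))// -!mulrA ler_wpM2l// ler_wpM2l//.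
  by rewrite ler_peMl.
- by rewrite -dotBr subrr normr0 mulr_ge0 ?exprn_ge0// mulr_ge0// mulr_ge0//
    (le_trans _ B1).
Qed.

Lemma c11D f1 g1 f2 g2 : c11 f1 g1 -> c11 f2 g2 ->
  c11 (fun x => f1 x + f2 x) (fun x => g1 x + g2 x).
Proof.
move=> H1 H2 B; have [C1 K1] := H1 B; have [C2 K2] := H2 B.
exists (C1 + C2) => x y s xB yB s0 hs.
have [a1 b1 c1] := K1 x y s xB yB s0 hs; have [a2 b2 c2] := K2 x y s xB yB s0 hs.
split.
- by rewrite (le_trans (ler_normD _ _))// lerD.
- by rewrite opprD addrACA mulrDl (le_trans (ler_normD _ _))// lerD.
- rewrite dotDl mulrDl; apply: le_trans (lerD c1 c2).
  by apply: le_trans (ler_normD _ _); rewrite le_eqVlt; apply/orP; left;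
     apply/eqP; congr (`|_|); ring.
Qed.

Lemma c11M f1 g1 f2 g2 : c11 f1 g1 -> c11 f2 g2 ->
  c11 (fun x => f1 x * f2 x) (fun x => f1 x *: g2 x + f2 x *: g1 x).
Proof.
move=> H1 H2 B; have [C1 C10 K1] := c11_ge0 B H1.
have [C2 C20 K2] := c11_ge0 B H2.
have C12 : 0 <= C1 * C2 by rewrite mulr_ge0.
exists (3 * (C1 * C2)) => x y s xB yB s0 hs.
have [a1 b1 c1] := K1 x y s xB yB s0 hs; have [a2 b2 c2] := K2 x y s xB yB s0 hs.
have [a2' _ _] := K2 y y s yB yB s0 (boxBB y s0).
split.
- rewrite normrM (le_trans (ler_pM _ _ a1 a2))// ler_peMl//.
  by rewrite ler1n.
- have -> : f1 y * f2 y - f1 x * f2 x =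
    (f1 y - f1 x) * f2 y + f1 x * (f2 y - f2 x) by ring.
  rewrite (le_trans (ler_normD _ _))// !normrM.
  apply: (@le_trans _ _ (C1 * s * C2 + C1 * (C2 * s))).
    by apply: lerD; apply: ler_pM.
  have := mulr_ge0 C12 s0; nra.
- rewrite dotDl !dotZl.
  have -> : f1 y * f2 y - f1 x * f2 x -
      (f1 x * dot (g2 x) (y - x) + f2 x * dot (g1 x) (y - x)) =
    (f1 y - f1 x) * (f2 y - f2 x) +
    (f1 x * (f2 y - f2 x - dot (g2 x) (y - x)) +
     f2 x * (f1 y - f1 x - dot (g1 x) (y - x))) by ring.
  rewrite (le_trans (ler_normD _ _))//.
  have -> : 3 * (C1 * C2) * s ^+ 2 =
    C1 * s * (C2 * s) + (C1 * (C2 * s ^+ 2) + C2 * (C1 * s ^+ 2)) by ring.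
  apply: lerD; first by rewrite normrM ler_pM.
  rewrite (le_trans (ler_normD _ _))// !normrM.
  by apply: lerD; apply: ler_pM.
Qed.

Lemma c11Z c f g : c11 f g -> c11 (fun x => c * f x) (fun x => c *: g x).
Proof.
move=> /(c11M (c11_cst c)); apply: c11_eqgrad => x.
by rewrite scaler0 addr0.
Qed.

Lemma c11_sum (I : Type) (r : seq I) (f : I -> 'cV[R]_d -> R)
    (g : I -> 'cV[R]_d -> 'cV[R]_d) : (forall i, c11 (f i) (g i)) ->
  c11 (fun x => \sum_(i <- r) f i x) (fun x => \sum_(i <- r) g i x).
Proof.
move=> H; elim: r => [|i r IH].
  apply: (c11_eqfun (f := fun=> 0)) => [x|]; first by rewrite big_nil.
  by apply: c11_eqgrad (c11_cst 0) => x; rewrite big_nil.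
apply: (c11_eqfun (f := fun x => f i x + \sum_(i <- r) f i x)).
  by move=> x; rewrite big_cons.
by apply: c11_eqgrad (c11D (H i) IH) => x; rewrite big_cons.
Qed.

Lemma c11_affine u m : c11 (fun x => dot u (x - m)) (fun=> u).
Proof.
apply: (c11_eqfun (f := fun x => dot u x + (- dot u m))) => [x|].
  by rewrite dotBr.
apply: c11_eqgrad (c11D (c11_dot u) (c11_cst (- dot u m))) => x.
by rewrite addr0.
Qed.

Lemma expR_sub1_le (t : R) : `|expR t - 1| <= `|t| * expR `|t|.
Proof.
have p1 := expR_ge1Dx t; have p2 := expR_ge1Dx (- t).
have e0 := expR_gt0 t; have e1 : 1 <= expR `|t| by rewrite -expR0 ler_expR.
have em : expR t * expR (- t) = 1 by rewrite expRxMexpNx_1.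
have et : expR t <= expR `|t| by rewrite ler_expR ler_norm.
case: (leP 0 t) => t0.
  rewrite ger0_norm; last by nra.
  rewrite (ger0_norm t0); nra.
rewrite ler0_norm; last by rewrite subr_le0 -expR0 ler_expR ltW.
rewrite (ltr0_norm t0); rewrite (ltr0_norm t0) in e1; nra.
Qed.

Lemma expR_taylor1 (t : R) : `|expR t - 1 - t| <= t ^+ 2 * expR `|t|.
Proof.
have p1 := expR_ge1Dx t.
have p2 := expR_ge1Dx (- t).
have e0 := expR_gt0 t.
have em : expR t * expR (- t) = 1 by rewrite expRxMexpNx_1.
rewrite ger0_norm; last by lra.
apply: (@le_trans _ _ (t * (expR t - 1))); first by nra.
apply: le_trans (ler_norm _) _; rewrite normrM.
rewrite -(real_normK (num_real t)) expr2 -mulrA ler_wpM2l//; exact: expR_sub1_le.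
Qed.

Lemma c11_expR f g : c11 f g ->
  c11 (fun x => expR (f x)) (fun x => expR (f x) *: g x).
Proof.
move=> H B; have [C C0 K] := c11_ge0 B H.
pose E := expR (2 * C).
have E0 : 0 < E by exact: expR_gt0.
have eC0 : 0 < expR C by exact: expR_gt0.
exists (expR C * (1 + C * E + C ^+ 2 * E + C)) => x y s xB yB s0 hs.
have [a b c] := K x y s xB yB s0 hs.
have [a' _ _] := K y y s yB yB s0 (boxBB y s0).
have eE : expR `|f y - f x| <= E.
  rewrite ler_expR (le_trans (ler_normB _ _))//; lra.
have CE : 0 <= C * E by rewrite mulr_ge0// ltW.
have C2E : 0 <= C ^+ 2 * E by rewrite mulr_ge0 ?exprn_ge0// ltW.
have efC : expR (f x) <= expR C by rewrite ler_expR (le_trans (ler_norm _)).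
have ef0 := expR_gt0 (f x).
have eyx : expR (f y) = expR (f x) * expR (f y - f x).
  by rewrite -expRD; congr expR; ring.
split.
- rewrite gtr0_norm// (le_trans efC)// ler_peMr ?(ltW eC0)//; lra.
- have -> : expR (f y) - expR (f x) = expR (f x) * (expR (f y - f x) - 1).
    by rewrite eyx; ring.
  rewrite normrM gtr0_norm// -mulrA ler_pM ?(ltW ef0)//.
  apply: le_trans (expR_sub1_le _) _.
  apply: (@le_trans _ _ (C * s * E)); first by rewrite ler_pM// expR_ge0.
  have -> : C * s * E = C * E * s by ring.
  by rewrite ler_wpM2r//; lra.
- rewrite dotZl.
  have -> : expR (f y) - expR (f x) - expR (f x) * dot (g x) (y - x) =
    expR (f x) * ((expR (f y - f x) - 1 - (f y - f x)) +
                  (f y - f x - dot (g x) (y - x))).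
    by rewrite eyx; ring.
  rewrite normrM gtr0_norm// -mulrA ler_pM ?(ltW ef0)//.
  rewrite (le_trans (ler_normD _ _))//.
  apply: (@le_trans _ _ ((C * s) ^+ 2 * E + C * s ^+ 2)).
    apply: lerD => //; apply: le_trans (expR_taylor1 _) _.
    apply: ler_pM => //; rewrite ?sqr_ge0 ?expR_ge0//.
    by rewrite -real_normK ?num_real// lerXn2r// nnegrE// mulr_ge0.
  have := exprn_ge0 2 s0; nra.
Qed.

Lemma c11V f g : c11 f g ->
  (forall B, exists2 c, 0 < c & forall x, box B x -> c <= f x) ->
  c11 (fun x => (f x)^-1) (fun x => - (f x) ^- 2 *: g x).
Proof.
move=> H Hf B; have [C C0 K] := c11_ge0 B H; have [c c0 fc] := Hf B.
pose e := c^-1; have e0 : 0 < e by rewrite invr_gt0.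
exists (e + C * e ^+ 2 + C * e ^+ 2 + C ^+ 2 * e ^+ 3) => x y s xB yB s0 hs.
have [b1 b2 b3] := K x y s xB yB s0 hs.
have fx0 : 0 < f x := lt_le_trans c0 (fc x xB).
have fy0 : 0 < f y := lt_le_trans c0 (fc y yB).
have ex : (f x)^-1 <= e by rewrite lef_pV2 ?posrE ?fc.
have ey : (f y)^-1 <= e by rewrite lef_pV2 ?posrE ?fc.
have Ce : 0 <= C * e ^+ 2 by rewrite mulr_ge0// exprn_ge0// ltW.
have Ce3 : 0 <= C ^+ 2 * e ^+ 3 by rewrite mulr_ge0// exprn_ge0// ltW.
have ix0 : 0 <= (f x)^-1 by rewrite invr_ge0 ltW.
have iy0 : 0 <= (f y)^-1 by rewrite invr_ge0 ltW.
split.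
- rewrite ger0_norm//; lra.
- have -> : (f y)^-1 - (f x)^-1 = - (f y - f x) * ((f x)^-1 * (f y)^-1).
    by field; rewrite !gt_eqF.
  rewrite normrM normrN [X in _ * X]ger0_norm ?mulr_ge0//.
  apply: (@le_trans _ _ (C * s * (e * e))).
    by rewrite ler_pM ?mulr_ge0// ler_pM.
  have -> : C * s * (e * e) = C * e ^+ 2 * s by ring.
  by rewrite ler_wpM2r//; lra.
- rewrite dotZl.
  have -> : (f y)^-1 - (f x)^-1 - - (f x) ^- 2 * dot (g x) (y - x) =
    (f y - f x) ^+ 2 * ((f x)^-1 * (f x)^-1 * (f y)^-1)
    - (f x)^-1 * (f x)^-1 * (f y - f x - dot (g x) (y - x)).
    by field; rewrite !gt_eqF.
  rewrite (le_trans (ler_normB _ _))// !normrM !(ger0_norm ix0) (ger0_norm iy0).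
  apply: (@le_trans _ _ ((C * s) ^+ 2 * (e * e * e) + e * e * (C * s ^+ 2))).
    apply: lerD.
      by apply: ler_pM; rewrite ?mulr_ge0// ?ler_pM ?mulr_ge0// normrX lerXn2r
         ?nnegrE ?mulr_ge0.
    by apply: ler_pM; rewrite ?mulr_ge0// ler_pM.
  have -> : (C * s) ^+ 2 * (e * e * e) + e * e * (C * s ^+ 2) =
    (C ^+ 2 * e ^+ 3 + C * e ^+ 2) * s ^+ 2 by ring.
  by rewrite ler_wpM2r ?exprn_ge0//; lra.
Qed.

End C11.

(** * Sard's theorem by counting grid points *)

Lemma mod_close_eq (a b L : nat) : (a <= b + L)%N -> (b <= a + L)%N ->
  (a %% L.+1 = b %% L.+1)%N -> a = b.
Proof.
wlog ab : a b / (a <= b)%N => [W h1 h2 e|_ h2 /eqP e].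
  by case/orP: (leq_total a b) => ab; [|symmetry]; apply: W.
have : (L.+1 %| b - a)%N by rewrite -eqn_mod_dvd// eq_sym.
case: (posnP (b - a)%N) => [/eqP|p0 /(dvdn_leq p0)]; last first.
  by rewrite leqNgt ltnS leq_subLR h2.
by rewrite subn_eq0 => ba _; apply/eqP; rewrite eqn_leq ab.
Qed.

(** Grid points of a slab: in the direction [j0] across the slab a point is
    determined up to [c] by its other coordinates, which vary by at most [L], so
    residues modulo [c.+1] and [L.+1] identify the point. *)
Lemma card_slab (n M L c : nat) (j0 : 'I_n.+1)
    (A : {set {ffun 'I_n.+1 -> 'I_M}}) :
  (forall p q, p \in A -> q \in A -> forall j, (p j <= q j + L)%N) ->
  (forall p q, p \in A -> q \in A -> (forall j, j != j0 -> p j = q j) ->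
     (p j0 <= q j0 + c)%N) ->
  (#|A| <= L.+1 ^ n * c.+1)%N.
Proof.
move=> HL Hc.
pose F (p : {ffun 'I_n.+1 -> 'I_M}) :=
  ([ffun j : 'I_n => inord (p (lift j0 j) %% L.+1)%N : 'I_L.+1],
   inord (p j0 %% c.+1)%N : 'I_c.+1).
have Finj : {in A &, injective F}.
  move=> p q pA qA [/ffunP Fj F0].
  have Hj j : j != j0 -> p j = q j.
    rewrite eq_sym => /unlift_some[i -> _].
    have := Fj i; rewrite !ffunE => /(congr1 val) /=.
    rewrite !inordK ?ltn_pmod// => e; apply: val_inj.
    by apply: mod_close_eq e; apply: HL.
  apply/ffunP => j; have [->|/Hj//] := eqVneq j j0.
  move/(congr1 val): F0; rewrite /= !inordK ?ltn_pmod// => e; apply: val_inj.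
  by apply: mod_close_eq e; apply: Hc => // i /Hj.
rewrite -(card_in_imset Finj) (leq_trans (max_card _))//.
by rewrite card_prod card_ffun !card_ord.
Qed.

Lemma card_fibers (Z Q : finType) (f : Z -> Q) (K : nat) :
  (forall u, #|[set z | f z == u]| <= K)%N -> (#|Z| <= #|Q| * K)%N.
Proof.
move=> H; rewrite -sum1_card (partition_big f predT)//= -sum_nat_const.
by apply: leq_sum => u _; rewrite sum1dep_card.
Qed.

Section Sard.
Variables (R : realType) (n : nat).
Local Notation d := n.+1.
Implicit Types (x y z h : 'cV[R]_d).

Lemma argmax_coord h : exists j0, box `|h j0 0| h.
Proof.
have [j0 _ H] := arg_maxP (fun j => `|h j 0|) (isT : predT (ord0 : 'I_d)).
by exists j0 => j; apply: H.
Qed.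

Lemma fin_box_bounded (I : finType) (F : I -> 'cV[R]_d) :
  exists2 M, 0 <= M & forall i, box M (F i).
Proof.
have /fin_all_exists2[K K0 HK] : forall i, exists2 M, 0 <= M & box M (F i).
  by move=> i; have [j hj] := argmax_coord (F i); exists `|F i j 0|.
exists (\sum_i K i) => [|i]; first exact: sumr_ge0.
by apply: box_le (HK i); rewrite (bigD1 i)//= lerDl sumr_ge0.
Qed.

Lemma box_bounded h : exists2 M, 0 <= M & box M h.
Proof. by have [M M0 HM] := fin_box_bounded (fun _ : unit => h); exists M => //; exact: HM tt. Qed.

(** Index of the cell containing x when the cube of radius b is cut into
    N.+1 ^ d equal cells. *)
Definition cell (b : R) (N : nat) x : {ffun 'I_d -> 'I_N.+1} :=
  [ffun j => inord (Num.truncn ((x j 0 + b) / (2 * b) * N.+1%:R))].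

Lemma cell_box (b c : R) N x y : 0 <= c < b -> box c x -> box c y ->
  cell b N x = cell b N y -> box (2 * b / N.+1%:R) (y - x).
Proof.
move=> /andP[c0 cb] xc yc /ffunP e j; have := e j; rewrite !ffunE.
have b0 : 0 < b := le_lt_trans c0 cb.
have N0 : 0 < N.+1%:R :> R by [].
pose u z := (z j 0 + b) / (2 * b) * N.+1%:R.
have H z : box c z -> 0 <= u z < N.+1%:R.
  move=> /(_ j); rewrite ler_norml => /andP[z1 z2]; apply/andP; split.
    by rewrite /u mulr_ge0// divr_ge0//; lra.
  by rewrite /u gtr_pMl// ltr_pdivrMr; lra.
have K z : box c z -> (Num.truncn (u z) < N.+1)%N.
  by move=> /H /andP[u0 u1]; rewrite truncn_lt_nat.
move/(congr1 val) => /=; rewrite !inordK ?K// => exy.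
have /andP[ux0 _] := H x xc; have /andP[uy0 _] := H y yc.
have /andP[x1 x2] := truncn_itv ux0; have /andP[y1 y2] := truncn_itv uy0.
have : `|u y - u x| <= 1.
  rewrite -/(u x) -/(u y) in exy; rewrite exy in x1 x2.
  rewrite -natr1 in x2 y2; rewrite ler_norml; lra.
have -> : u y - u x = (y - x) j 0 * (N.+1%:R / (2 * b)).
  by rewrite /u !mxE; field; lra.
rewrite normrM [X in _ * X]gtr0_norm; last by rewrite divr_gt0//; lra.
by rewrite -ler_pdivlMr ?invf_div ?mul1r//; rewrite divr_gt0//; lra.
Qed.

Variables (G : 'cV[R]_d -> 'cV[R]_d) (D : 'cV[R]_d -> 'M[R]_d).
Hypothesis GD : forall j, c11 (fun x => G x j 0) (fun x => (row j (D x))^T).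
Hypothesis Dsym : forall x, (D x)^T = D x.

(** Two points with the same value of G whose difference h is small force G to
    vary little in the direction h: the derivative at x sends h to O(|h|^2), and
    by symmetry the component along h of D (z - x) is (D h).(z - x). *)
Lemma degenerate_slab (b : R) : exists2 C, 0 <= C & forall x y (s sig : R),
  box b x -> box b y -> G x = G y -> 0 <= s <= sig -> box s (y - x) ->
  forall z, box b z -> box sig (z - x) ->
  box (C * sig) (G z - G x) /\
  `|dot (y - x) (G z - G x)| <= C * (s * sig ^+ 2).
Proof.
have /fin_all_exists2[C C0 HC] : forall j, exists2 C, 0 <= C &
  forall x y (s : R), box b x -> box b y -> 0 <= s -> box s (y - x) ->
  [/\ `|G x j 0| <= C, `|G y j 0 - G x j 0| <= C * s
    & `|G y j 0 - G x j 0 - dot ((row j (D x))^T) (y - x)| <= C * s ^+ 2].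
  by move=> j; apply: c11_ge0 (GD j).
pose K := \sum_j C j.
have K0 : 0 <= K by apply: sumr_ge0.
have CK j : C j <= K by rewrite /K (bigD1 j)//= lerDl sumr_ge0.
pose E := K + 2 * d%:R * K.
have dK0 : 0 <= d%:R * K by rewrite mulr_ge0.
exists E => [|x y s sig xb yb Gxy /andP[s0 ssig] hs z zb hz].
  by rewrite /E; lra.
have sig0 : 0 <= sig := le_trans s0 ssig.
have Gz : box (K * sig) (G z - G x).
  move=> l; rewrite !mxE; have [_ h _] := HC l x z sig xb zb sig0 hz.
  by rewrite (le_trans h)// ler_wpM2r.
split; first by apply: box_le Gz; rewrite ler_wpM2r// /E; lra.
pose r := G z - G x - D x *m (z - x).
have rb : box (K * sig ^+ 2) r.
  move=> l; have [_ _] := HC l x z sig xb zb sig0 hz.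
  rewrite dot_row /r !mxE => h; rewrite (le_trans h)// ler_wpM2r// exprn_ge0//.
have Dh : box (K * s ^+ 2) (D x *m (y - x)).
  move=> l; have [_ _] := HC l x y s xb yb s0 hs.
  rewrite Gxy subrr sub0r normrN dot_row => h.
  by rewrite (le_trans h)// ler_wpM2r// exprn_ge0.
have -> : G z - G x = r + D x *m (z - x) by rewrite /r subrK.
rewrite dotDr dot_sym// (le_trans (ler_normD _ _))//.
rewrite (le_trans (lerD (dot_box hs rb) (dot_box Dh hz)))//.
have P : 0 <= s * sig ^+ 2 by rewrite mulr_ge0// exprn_ge0.
have Q : d%:R * (K * s ^+ 2 * sig) <= d%:R * K * (s * sig ^+ 2).
  have -> : d%:R * (K * s ^+ 2 * sig) = d%:R * K * (s * (s * sig)) by ring.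
  by rewrite ler_wpM2l// ler_wpM2l// expr2 ler_wpM2r.
rewrite /E; have := mulr_ge0 K0 P; lra.
Qed.

(** The slabs that contain the values taken twice in a cell have too few grid
    points to exhaust the grid; any other grid point is a suitable value. *)
Lemma quantitative_sard (B eta : R) : 0 < eta ->
  exists2 a : 'cV[R]_d, (forall j, 0 <= a j 0 <= eta) &
    finite_set [set x | box B x /\ G x = a].
Proof.
move=> eta0.
pose b := `|B| + 1.
have b0 : 0 < b by rewrite /b -[ltLHS]addr0 ltr_wpDl.
have Bb x : box B x -> box `|B| x by apply: box_le; exact: ler_norm.
have bb x : box B x -> box b x by apply: box_le; rewrite /b (le_trans (ler_norm _))// lerDl.
have Bltb : 0 <= `|B| < b by rewrite normr_ge0 /b ltrDl ltr01.
have [C C0 HC] := degenerate_slab b.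
(* c.+1 bounds, in grid steps, the thickness of a slab and, after division by N,
   its diameter. *)
pose c := Num.truncn ((4 * b + 8 * b ^+ 2) * C / eta).
have cle : (4 * b + 8 * b ^+ 2) * C / eta <= c.+1%:R.
  by rewrite ltW// truncnS_gt.
(* N exceeds the constant of the slab count, and the grid step is of order
   N^-2, the thickness of the slabs. *)
pose N' := (c.+2 ^ d)%N; pose N := N'.+1; pose M := (N ^ 2)%N.
have NR : 0 < N%:R :> R by [].
pose Z := {ffun 'I_d -> 'I_M}.
pose pt (p : Z) : 'cV[R]_d := \col_j (eta / M%:R * (p j)%:R).
have MR : 0 < M%:R :> R by rewrite ltr0n expn_gt0.
have ptI (p : Z) j : 0 <= pt p j 0 <= eta.
  rewrite mxE; apply/andP; split; first by rewrite mulr_ge0// divr_ge0// ltW.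
  by rewrite mulrAC ler_pdivrMr// ler_wpM2l ?(ltW eta0)// ler_nat ltnW.
have [[p Hp]|Hno] := pselect (exists p : Z, forall x y, box B x -> box B y ->
    G x = pt p -> G y = pt p -> cell b N' x = cell b N' y -> x = y).
  exists (pt p) => //.
  pose A : set 'cV[R]_d := [set x | box B x /\ G x = pt p]%classic.
  have inj : {in A &, injective (cell b N')}.
    by move=> x y; rewrite !inE => -[xB xp] [yB yp] e; apply: Hp.
  by rewrite -(eq_finite_set (inj_card_eq inj)); exact: finite_finset.
(* Otherwise every candidate value has two preimages in one cell. *)
exfalso.
have /choice[X HX] : forall p : Z, exists u : 'cV[R]_d * 'cV[R]_d,
  [/\ box B u.1, box B u.2, G u.1 = pt p, G u.2 = pt p
    & cell b N' u.1 = cell b N' u.2 /\ u.1 <> u.2].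
  move=> p; apply: contrapT => H; apply: Hno; exists p => x y xB yB xp yp e.
  by apply: contrapT => xy; apply: H; exists (x, y); split.
pose q p := cell b N' (X p).1.
have fib u : (#|[set p | q p == u]| <= (c.+1 * N).+1 ^ n * c.+2)%N.
  have [->|[p0]] := set_0Vmem [set p | q p == u]; first by rewrite cards0.
  rewrite inE => /eqP qp0; have [B1 B2 e1 e2 [ec ne]] := HX p0.
  set x0 := (X p0).1 in B1 e1 ec ne qp0; set y0 := (X p0).2 in B2 e2 ec ne.
  have [j0 hj0] := argmax_coord (y0 - x0).
  set s := `|(y0 - x0) j0 0| in hj0.
  have s0 : 0 < s.
    rewrite lt_neqAle normr_ge0 andbT eq_sym; apply/eqP => s0; apply: ne.
    apply/esym/eqP; rewrite -subr_eq0; apply/eqP/colP => j.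
    by have := hj0 j; rewrite s0 normr_le0 => /eqP ->; rewrite mxE.
  pose sig := 2 * b / N%:R.
  have ssig : s <= sig by apply: (cell_box Bltb) => //; exact: Bb.
  have H p : p \in [set p | q p == u] ->
     box (C * sig) (pt p - pt p0) /\
     `|dot (y0 - x0) (pt p - pt p0)| <= C * (s * sig ^+ 2).
    rewrite inE => /eqP qp; have [A1 _ f1 _ _] := HX p.
    rewrite -f1 -e1; apply: HC => //; try exact: bb.
    - by rewrite e1.
    - by rewrite ltW.
    - by apply: (cell_box Bltb); [exact: Bb|exact: Bb|exact: etrans qp0 (esym qp)].
  have sigE : sig = 2 * b / N%:R by [].
  have ME : M%:R = N%:R ^+ 2 :> R by rewrite /M natrX.
  apply: (card_slab (j0 := j0)) => p p' pA p'A.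
    move=> j; have [/(_ j) h1 _] := H p pA; have [/(_ j) h2 _] := H p' p'A.
    rewrite -(ler_nat R) natrD natrM -lerBlDl.
    rewrite !mxE in h1 h2.
    have : eta / M%:R * ((p j)%:R - (p' j)%:R) <= 2 * (C * sig).
      move: h1 h2; rewrite !ler_norml; lra.
    rewrite -ler_pdivlMl ?divr_gt0// => /le_trans; apply.
    rewrite invf_div ME sigE.
    have -> : N%:R ^+ 2 / eta * (2 * (C * (2 * b / N%:R))) =
      (4 * b) * C / eta * N%:R by field; rewrite !gt_eqF.
    rewrite ler_wpM2r// (le_trans _ cle)// ler_wpM2r ?invr_ge0 ?(ltW eta0)//.
    by rewrite ler_wpM2r// lerDl mulr_ge0// exprn_ge0// ltW.
  move=> pp'; have [_ h1] := H p pA; have [_ h2] := H p' p'A.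
  rewrite -(ler_nat R) natrD -lerBlDl.
  have : `|dot (y0 - x0) (pt p - pt p')| <= 2 * (C * (s * sig ^+ 2)).
    have -> : pt p - pt p' = (pt p - pt p0) - (pt p' - pt p0).
      by rewrite opprB addrA subrK.
    rewrite dotBr (le_trans (ler_normB _ _))//; lra.
  rewrite dotE (bigD1 j0)//= big1 ?addr0; last first.
    by move=> j /pp' e; rewrite !mxE e subrr mulr0.
  rewrite normrM -/s.
  have -> : (pt p - pt p') j0 0 = eta / M%:R * ((p j0)%:R - (p' j0)%:R).
    by rewrite !mxE; ring.
  have -> : 2 * (C * (s * sig ^+ 2)) = s * (2 * C * sig ^+ 2) by ring.
  rewrite ler_pM2l// => /(le_trans (ler_norm _)).
  rewrite -ler_pdivlMl ?divr_gt0// => /le_trans; apply.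
  rewrite invf_div ME sigE.
  have -> : N%:R ^+ 2 / eta * (2 * C * (2 * b / N%:R) ^+ 2) =
      (8 * b ^+ 2) * C / eta by field; rewrite !gt_eqF.
  rewrite (le_trans _ cle)// ler_wpM2r ?invr_ge0 ?(ltW eta0)//.
  by rewrite ler_wpM2r// lerDr mulr_ge0// ltW.
have := card_fibers fib; rewrite !card_ffun !card_ord.
apply/negP; rewrite -ltnNge.
have -> : (M ^ d = N ^ d * N ^ d)%N by rewrite /M expnAC mulnn.
rewrite ltn_pmul2l ?expn_gt0//.
have cN : ((c.+1 * N).+1 <= c.+2 * N)%N by rewrite [leqRHS]mulSn -(add1n (c.+1 * N)) leq_add2r.
have cNn : ((c.+1 * N).+1 ^ n <= (c.+2 * N) ^ n)%N.
  by case: (n) => // m; rewrite leq_exp2r.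
apply: (@leq_ltn_trans (c.+2 ^ d * N ^ n)%N).
  by rewrite expnSr mulnAC -expnMn leq_mul2r cNn orbT.
by rewrite [in ltnRHS]expnS ltn_pmul2r ?expn_gt0// /N /N' ltnS.
Qed.

End Sard.

(** * Modes of Gaussian sums and the score equation *)

Section Modes.
Variables (R : realType).

Lemma coord_le_euclidean_norm d (h : 'cV[R]_d) j : `|h j 0| <= euclidean_norm h.
Proof.
rewrite /euclidean_norm -sqrtr_sqr ler_sqrt; last first.
  by apply: sumr_ge0 => i _; exact: sqr_ge0.
by rewrite (bigD1 j)//= lerDl sumr_ge0// => i _; exact: sqr_ge0.
Qed.

Lemma euclidean_norm_delta d (t : R) (j : 'I_d) :
  euclidean_norm (t *: delta_mx j 0 : 'cV[R]_d) = `|t|.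
Proof.
rewrite /euclidean_norm (bigD1 j)//= big1 ?addr0 => [|i ij].
  by rewrite !mxE !eqxx mulr1 sqrtr_sqr.
by rewrite !mxE (negbTE ij) mulr0 expr0n.
Qed.

Lemma modesZ d (c : R) (f : 'cV[R]_d -> R) : 0 < c ->
  modes (fun x => c * f x) = modes f.
Proof.
move=> c0; apply/seteqP; split=> x [rho r0 H]; exists rho => // y /H.
- by rewrite ler_pM2l.
- by rewrite ler_pM2l.
Qed.

Lemma mode_grad0 n f g (x : 'cV[R]_n.+1) : c11 f g -> modes f x -> g x = 0.
Proof.
move=> Hf [rho rho0 Hx]; apply/colP => j; rewrite [RHS]mxE.
apply: contrapT => /eqP gj0.
have [b b0 xb] := box_bounded x.
have [C C0 HC] := c11_ge0 (b + 1) Hf.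
have p0 : 0 < `|g x j 0| by rewrite normr_gt0.
(* A step of length t along the j-th axis gains t * |g x j| up to C * t ^+ 2. *)
pose t := Num.min (rho / 2) (Num.min 1 (`|g x j 0| / (2 * (C + 1)))).
have q0 : 0 < `|g x j 0| / (2 * (C + 1)) by rewrite divr_gt0//; lra.
have t0 : 0 < t by rewrite !lt_min q0 ltr01 andbT divr_gt0.
have t1 : t <= 1 by rewrite !ge_min lexx /= orbT.
have t2 : t <= rho / 2 by rewrite ge_min lexx.
have t3 : t * (2 * (C + 1)) <= `|g x j 0|.
  by rewrite -ler_pdivlMr ?ge_min ?lexx ?orbT//; lra.
pose h : 'cV[R]_n.+1 := (Num.sg (g x j 0) * t) *: delta_mx j 0.
have nh : `|Num.sg (g x j 0) * t| = t.
  by rewrite normrM normr_sg gj0 mul1r gtr0_norm.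
have ht : box t h.
  by move=> i; rewrite (le_trans (coord_le_euclidean_norm h i))// euclidean_norm_delta nh.
have yx : x + h - x = h by rewrite addrAC subrr add0r.
have /Hx : euclidean_norm (x + h - x) < rho.
  by rewrite yx euclidean_norm_delta nh; lra.
have [] := HC x (x + h) t.
- by apply: box_le xb; lra.
- rewrite -[h]opprK; apply: boxB => //; apply: boxN; exact: box_le ht.
- exact: ltW.
- by rewrite yx.
move=> _ _; rewrite yx dotZr dotC dot_delta.
have -> : Num.sg (g x j 0) * t * g x j 0 = t * `|g x j 0|.
  by rewrite normrEsg; ring.
rewrite ler_norml => /andP[h1 _] h2.
have : t * (`|g x j 0| - C * t) <= 0 by rewrite mulrBr; nra.
rewrite pmulr_rle0//; nra.
Qed.

End Modes.

Section Bumps.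
Variables (R : realType) (n : nat).
Local Notation d := n.+1.
Implicit Types (x y m u v a : 'cV[R]_d) (P : 'M[R]_d).

Definition bump m P x : R := expR (- (1 / 2) * dot (x - m) (P *m (x - m))).

Lemma c11_quad m P : P^T = P ->
  c11 (fun x => - (1 / 2) * dot (x - m) (P *m (x - m)))
      (fun x => - (P *m (x - m))).
Proof.
move=> sP.
apply: (c11_eqfun (f := fun x => - (1 / 2) * \sum_j
   dot (delta_mx j 0) (x - m) * dot ((row j P)^T) (x - m))) => [x|].
  by rewrite dotE; congr (_ * _); apply: eq_bigr => j _; rewrite dot_delta dot_row.
apply: c11_eqgrad; last first.
  by apply: c11Z; apply: c11_sum => j; apply: c11M; apply: c11_affine.
move=> x /=.
have -> : \sum_j (dot (delta_mx j 0) (x - m) *: (row j P)^T +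
     dot ((row j P)^T) (x - m) *: delta_mx j 0) = 2 *: (P *m (x - m)).
  rewrite big_split /= scaler_nat mulr2n; congr (_ + _).
    rewrite -[in RHS]sP; apply/colP => l; rewrite summxE mxE.
    by apply: eq_bigr => j _; rewrite dot_delta !mxE mulrC.
  apply/colP => l; rewrite summxE (bigD1 l)//= big1 ?addr0 => [|j jl].
    by rewrite dot_row !mxE !eqxx mulr1.
  by rewrite !mxE eq_sym (negbTE jl) mulr0.
by rewrite scalerA mulNr mul1r mulVf ?pnatr_eq0// scaleN1r.
Qed.

Lemma bump_gt0 m P x : 0 < bump m P x. Proof. exact: expR_gt0. Qed.

Lemma c11_bump m P : P^T = P ->
  c11 (bump m P) (fun x => - (bump m P x *: (P *m (x - m)))).
Proof.
by move=> /(c11_quad m)/c11_expR; apply: c11_eqgrad => x; rewrite scalerN.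
Qed.

Lemma mulmx0_unit (A : 'M[R]_d) : (forall v, A *m v = 0 -> v = 0) ->
  A \in unitmx.
Proof.
move=> H; rewrite -unitmx_tr -row_free_unit; apply/inj_row_free => v.
move=> /(congr1 trmx); rewrite trmx_mul trmxK trmx0 => /H.
by move=> /(congr1 trmx); rewrite trmxK trmx0.
Qed.

Lemma dot_gt0 v : v != 0 -> 0 < dot v v.
Proof.
move=> v0; rewrite dotE lt_neqAle eq_sym sumr_ge0 ?andbT => [|j _]; last first.
  by rewrite -expr2 sqr_ge0.
rewrite psumr_eq0 => [|j _]; last by rewrite -expr2 sqr_ge0.
apply: contraNN v0 => /allP H; apply/eqP/colP => j; rewrite [RHS]mxE.
by have := H j (mem_index_enum _); rewrite /= mulf_eq0 orbb => /eqP.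
Qed.

Definition coercive (delta : R) P :=
  P^T = P /\ forall v, delta * dot v v <= dot v (P *m v).

Lemma coercive_unit delta P : 0 < delta -> coercive delta P -> P \in unitmx.
Proof.
move=> d0 [_ H]; apply: mulmx0_unit => v Pv0; apply/eqP; apply/negPn/negP => v0.
have := H v; rewrite Pv0 (_ : dot v 0 = 0); last by rewrite dotC dot0l.
by rewrite leNgt mulr_gt0// dot_gt0.
Qed.

Lemma coercive_inv_posdef delta P : 0 < delta -> coercive delta P ->
  posdefmx (invmx P).
Proof.
move=> d0 cP; have uP := coercive_unit d0 cP; have [sP H] := cP.
have sI : (invmx P)^T = invmx P by rewrite trmx_inv sP.
split=> // v v0.
have w0 : invmx P *m v != 0.
  by apply: contraNN v0 => /eqP w0; rewrite -(mulKVmx uP v) w0 mulmx0.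
rewrite -mulmxA -/(dot v (invmx P *m v)) -{1}(mulKVmx uP v) dotC.
by rewrite (lt_le_trans _ (H _))// mulr_gt0// dot_gt0.
Qed.

Lemma gaussian_density_bump m P : P \in unitmx ->
  exists2 c, 0 < c & forall x, gaussian_density m (invmx P) x = c * bump m P x.
Proof.
move=> uP.
exists ((2 * pi) `^ (- (d%:R / 2)) * (\det (invmx P)) `^ (- (1 / 2))).
  apply: mulr_gt0; first by rewrite powR_gt0// mulr_gt0// pi_gt0.
  (* A power with nonzero base is positive. *)
  rewrite lt_neqAle powR_ge0 andbT eq_sym powR_eq0 negb_and.
  by rewrite -unitfE -unitmxE unitmx_inv uP.
by move=> y; rewrite /gaussian_density invmxK /bump /dot mulmxA.
Qed.

(** Completing the square: a tilt moves the mean by P^-1 a and rescales. *)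
Lemma tilted_bumpE m P a : P^T = P -> P \in unitmx ->
  exists2 c, 0 < c &
    forall x, bump m P x * expR (dot a x) = c * bump (m + invmx P *m a) P x.
Proof.
move=> sP uP; set w := invmx P *m a.
have Pw : P *m w = a by rewrite /w mulKVmx.
exists (expR (dot a m + 1 / 2 * dot w a)); first exact: expR_gt0.
move=> x; rewrite /bump -!expRD; congr expR.
have -> : dot a x = dot a (x - m) + dot a m by rewrite -dotDr subrK.
have -> : x - (m + w) = x - m - w by rewrite opprD addrA.
move: (x - m) => y.
have e : dot (P *m y) w = dot a y by rewrite dotC dot_sym// Pw.
rewrite mulmxBr Pw !dotBr !(dotC (y - w)) !dotBr e (dotC (P *m y)) (dotC a w).
by field.
Qed.

Variables (k : nat) (m : 'I_k -> 'cV[R]_d) (P : 'I_k -> 'M[R]_d).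
Variables (i0 : 'I_k) (delta : R).
Hypothesis delta0 : 0 < delta.
Hypothesis coP : forall i, coercive delta (P i).

Definition bumps x := \sum_i bump (m i) (P i) x.
Definition tilted a x := bumps x * expR (dot a x).

Lemma bumps_gt0 x : 0 < bumps x.
Proof.
rewrite /bumps (bigD1 i0)//= ltr_pwDl ?bump_gt0// sumr_ge0// => i _.
exact/ltW/bump_gt0.
Qed.

Lemma tilted_mixture a : exists2 c, 0 < c &
  is_gaussian_mixture k (fun x => c * tilted a x).
Proof.
pose mu i := m i + invmx (P i) *m a.
have /fin_all_exists2[c c0 Hc] : forall i, exists2 c, 0 < c & forall x,
    bump (m i) (P i) x * expR (dot a x) = c * gaussian_density (mu i) (invmx (P i)) x.
  move=> i; have uP := coercive_unit delta0 (coP i).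
  have [c1 c10 H1] := tilted_bumpE (m i) a (coP i).1 uP.
  have [c2 c20 H2] := gaussian_density_bump (mu i) uP.
  exists (c1 / c2) => [|x]; first exact: divr_gt0.
  by rewrite H1 H2 -mulrA; congr (_ * _); rewrite mulKf// gt_eqF.
have Z0 : 0 < \sum_i c i.
  rewrite (bigD1 i0)//= ltr_pwDl// sumr_ge0// => i _; exact: ltW.
exists (\sum_i c i)^-1; first by rewrite invr_gt0.
exists (fun i => (\sum_i c i)^-1 * c i), mu, (fun i => invmx (P i)); split.
- by move=> i; rewrite mulr_gt0// invr_gt0.
- by rewrite -mulr_sumr mulVf// gt_eqF.
- by move=> i; exact: coercive_inv_posdef delta0 (coP i).
- move=> x; rewrite /tilted /bumps mulr_suml mulr_sumr.
  by apply: eq_bigr => i _; rewrite -mulrA -Hc.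
Qed.

(** Minus the gradient of [bumps]. *)
Definition drift x := \sum_i bump (m i) (P i) x *: (P i *m (x - m i)).
(** Minus the gradient of the logarithm of [bumps]. *)
Definition score x := (bumps x)^-1 *: drift x.

Lemma c11_bumps : c11 bumps (fun x => - drift x).
Proof.
apply: c11_eqgrad (c11_sum _ (fun i => c11_bump (m i) (coP i).1)) => x.
by rewrite sumrN.
Qed.

(** Cancelling the positive factor exp(a.x) in the gradient isolates a. *)
Lemma mode_score a x : modes (tilted a) x -> score x = a.
Proof.
move=> /(mode_grad0 (c11M c11_bumps (c11_expR (c11_dot a)))).
rewrite scalerA mulrC -scalerA -scalerDr => /eqP.
rewrite scaler_eq0 expR_eq0 /= subr_eq0 => /eqP e.
by rewrite /score -e scalerA mulVf ?scale1r// gt_eqF// bumps_gt0.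
Qed.

(** The Jacobian matrix of [score], that is, minus the Hessian of log [bumps];
    this form displays its symmetry. *)
Definition dscore x : 'M[R]_d :=
  (bumps x)^-1 *: (\sum_i bump (m i) (P i) x *:
      (P i - (P i *m (x - m i)) *m (P i *m (x - m i))^T))
  + (bumps x) ^- 2 *: (drift x *m (drift x)^T).

Lemma dscore_sym x : (dscore x)^T = dscore x.
Proof.
rewrite /dscore linearD /= !linearZ /= linear_sum /= trmx_mul trmxK.
congr (_ *: _ + _); apply: eq_bigr => i _.
by rewrite linearZ /= linearB /= trmx_mul trmxK (coP i).1.
Qed.

Lemma bumps_lb B : exists2 c, 0 < c & forall x, box B x -> c <= bumps x.
Proof.
have [C C0 HC] := c11_ge0 B (c11_quad (m i0) (coP i0).1).
exists (expR (- C)) => [|x xB]; first exact: expR_gt0.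
rewrite /bumps (bigD1 i0)//= (le_trans (_ : _ <= bump (m i0) (P i0) x))//.
  have [h _ _] := HC x x 0 xB xB (lexx 0) (boxBB x (lexx 0)).
  by rewrite ler_expR; move: h; rewrite ler_norml => /andP[].
by rewrite lerDl sumr_ge0// => i _; exact/ltW/bump_gt0.
Qed.

Lemma c11_score j : c11 (fun x => score x j 0) (fun x => (row j (dscore x))^T).
Proof.
have K i := c11M (c11_bump (m i) (coP i).1) (c11_affine ((row j (P i))^T) (m i)).
have := c11M (c11V c11_bumps bumps_lb) (c11_sum (index_enum 'I_k) K).
move=> H; apply: c11_eqfun (c11_eqgrad _ H) => x.
  rewrite /score /drift mxE summxE; congr (_ * _); apply: eq_bigr => i _.
  by rewrite dot_row [RHS]mxE.
apply/colP => l; rewrite /dscore ![in RHS]mxE big_ord1 [in RHS]summxE.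
rewrite ![in LHS]mxE; congr (_ * _ + _).
  rewrite summxE; apply: eq_bigr => i _.
  rewrite dot_row; move: (P i *m (x - m i)) => u.
  by rewrite !mxE big_ord1 !mxE; ring.
rewrite [in RHS]mxE mulrN mulNr opprK mulrCA; congr (_ * (_ * _)).
rewrite summxE; apply: eq_bigr => i _; by rewrite dot_row [RHS]mxE.
Qed.

(** At a large x every component pulls inwards more strongly than a bounded tilt
    pushes: x.(P_i (x - m_i)) grows quadratically, x.a only linearly. *)
Lemma score_bounded : exists B, forall a x, box 1 a -> score x = a -> box B x.
Proof.
have [S S0 HS] := fin_box_bounded (fun i => P i *m m i).
exists (d%:R * (S + 1) / delta) => a x a1 xa.
have [j hj] := argmax_coord x; set t := `|x j 0| in hj; apply: box_le (hj).
rewrite leNgt; apply/negP; rewrite ltr_pdivrMr// => ht.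
have t0 : 0 < t.
  rewrite lt_neqAle normr_ge0 andbT; apply/eqP => t0.
  by move: ht; rewrite -t0 mul0r ltNge mulr_ge0//; lra.
have tx : t ^+ 2 <= dot x x.
  rewrite dotE (bigD1 j)//= -expr2 real_normK ?num_real// lerDl sumr_ge0//.
  by move=> i _; rewrite -expr2; exact: sqr_ge0.
have pos i : 0 < dot x (P i *m (x - m i)) - dot x a.
  have h1 := dot_box hj (HS i); have h2 := dot_box hj a1.
  rewrite mulmxBr dotBr.
  have h3 := (coP i).2 x.
  have h4 : delta * t ^+ 2 <= dot x (P i *m x).
    by rewrite (le_trans _ h3)// ler_wpM2l// ltW.
  move: h1 h2; rewrite !ler_norml => /andP[_ h1] /andP[_ h2].
  have : d%:R * (S + 1) * t < delta * t ^+ 2.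
    by rewrite expr2 mulrA ltr_pM2r// (mulrC delta).
  lra.
have : \sum_i bump (m i) (P i) x * (dot x (P i *m (x - m i)) - dot x a) = 0.
  transitivity (dot x (drift x) - bumps x * dot x a); last first.
    by rewrite -xa /score dotZr mulrA mulfV ?mul1r ?subrr// gt_eqF// bumps_gt0.
  rewrite /drift dot_sumr /bumps mulr_suml -sumrB; apply: eq_bigr => i _.
  by rewrite dotZr mulrBr.
move/eqP; rewrite gt_eqF// (bigD1 i0)//= ltr_pwDl ?mulr_gt0 ?bump_gt0//.
by rewrite sumr_ge0// => i _; rewrite ltW// mulr_gt0// bump_gt0.
Qed.

Lemma generic_tilt_finite_modes (eta : R) : 0 < eta -> exists2 a,
  box eta a & finite_set (modes (tilted a)).
Proof.
move=> eta0; have [B HB] := score_bounded.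
have e0 : 0 < Num.min eta 1 by rewrite lt_min eta0 ltr01.
have [a Ha fin] := quantitative_sard c11_score dscore_sym B e0.
have ba : box (Num.min eta 1) a.
  by move=> j; have /andP[a0 a1] := Ha j; rewrite ger0_norm.
exists a; first by apply: box_le ba; rewrite ge_min lexx.
apply: sub_finite_set fin => x /mode_score xa; split=> //.
by apply: HB xa; apply: box_le ba; rewrite ge_min lexx orbT.
Qed.

End Bumps.

(** * Modes inside a cube *)

Section InteriorMode.
Variables (R : realType) (n : nat).
Local Notation d := n.+1.

Lemma c11_continuous (f : 'cV[R]_d -> R) g : c11 f g ->
  continuous (fun v : 'rV[R]_d => f v^T).
Proof.
move=> Hf v; have [b b0 vb] := box_bounded v^T.
have [C C0 HC] := c11_ge0 (b + 1) Hf.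
move=> A /nbhs_ballP[e /= e0 eA].
have q0 : 0 < e / (C + 1) by rewrite divr_gt0//; lra.
pose s := Num.min 1 (e / (C + 1)).
have s0 : 0 < s by rewrite lt_min ltr01.
have s1 : s <= 1 by rewrite ge_min lexx.
apply/(nbhs_ballP v); exists s => //= w [_ vw]; apply: eA.
have hs : box s (w^T - v^T).
  by move=> j; rewrite !mxE distrC ltW//; exact: vw.
have [] := HC v^T w^T s _ _ (ltW s0) hs.
- by apply: box_le vb; lra.
- have -> : w^T = v^T - (v^T - w^T) by rewrite opprB addrC subrK.
  by apply: boxB => //; rewrite -opprB; apply: boxN; exact: box_le hs.
move=> _ h _; rewrite /ball /= distrC (le_lt_trans h)//.
rewrite (@le_lt_trans _ _ (C * (e / (C + 1))))//.
  by rewrite ler_wpM2l// ge_min lexx orbT.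
rewrite mulrCA -[ltRHS]mulr1 ltr_pM2l// ltr_pdivrMr; lra.
Qed.

(** A maximum over the closed cube exists by compactness, and it is interior
    because the centre beats the boundary. *)
Lemma interior_mode (f : 'cV[R]_d -> R) g (rho : R) p : c11 f g -> 0 < rho ->
  (forall y j, box rho (y - p) -> `|(y - p) j 0| = rho -> f y < f p) ->
  exists2 z, box rho (z - p) & modes f z.
Proof.
move=> Hf rho0 Hp.
pose A : set 'rV[R]_d :=
  [set v | forall i, `[p i 0 - rho, p i 0 + rho]%classic (v ord0 i)]%classic.
have AE v : A v <-> box rho (v^T - p).
  split=> [Av j|Av j] /=.
    have := Av j; rewrite /= in_itv/= => /andP[h1 h2].
    by rewrite !mxE ler_norml; lra.
  have := Av j; rewrite !mxE ler_norml in_itv/= => h; lra.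
have cA : compact A.
  by apply: (@rV_compact _ _ (fun i => `[p i 0 - rho, p i 0 + rho]%classic))
    => i; exact: segment_compact.
have pA : A p^T by apply/AE; rewrite trmxK; apply: boxBB; exact: ltW.
have [c cinA cmax] := compact_EVT_max (ex_intro _ _ pA) cA
  (continuous_subspaceT (c11_continuous Hf)).
move: cinA; rewrite inE => /AE cA'; exists c^T => //.
have [j0 hj0] := argmax_coord (c^T - p).
have lt0 : `|(c^T - p) j0 0| < rho.
  rewrite lt_neqAle cA' andbT; apply/negP => /eqP e.
  have := Hp _ _ cA' e; rewrite ltNge -{1}(trmxK p) cmax//.
  by rewrite inE.
exists (rho - `|(c^T - p) j0 0|); first by rewrite subr_gt0.
move=> y hy; rewrite -{1}(trmxK y) cmax// inE; apply/AE; rewrite trmxK => j.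
have -> : (y - p) j 0 = (y - c^T) j 0 + (c^T - p) j 0 by rewrite !mxE; ring.
rewrite (le_trans (ler_normD _ _))//.
have := hj0 j; have := coord_le_euclidean_norm (y - c^T) j; lra.
Qed.

End InteriorMode.

(** * Hyperplanes of polynomials with a prescribed root *)

Section Nodes.
Variables (R : realType) (n : nat).
Local Notation d := n.+1.
Implicit Types (x y h : 'cV[R]_d) (p : {poly R}).

Definition coefs p : 'cV[R]_d := \col_j p`_j.
Definition powers (t : nat) : 'cV[R]_d := \col_j t%:R ^+ j.
(** The value at t of the monic polynomial of degree d whose lower coefficients
    are the entries of x. *)
Definition value (t : nat) x : R := t%:R ^+ d + dot (powers t) x.

Lemma value_coefs t p : p \is monic -> size p = d.+1 ->
  value t (coefs p) = p.[t%:R].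
Proof.
move=> pm sp; rewrite horner_coef sp big_ord_recr /= addrC /value dotE.
have -> : p`_d = 1 by move/monicP: pm => <-; rewrite lead_coefE sp.
by rewrite mul1r; congr (_ + _); apply: eq_bigr => j _; rewrite !mxE mulrC.
Qed.

Lemma valueB t x y : value t y = value t x + dot (powers t) (y - x).
Proof. by rewrite /value dotBr; ring. Qed.

(** A polynomial of degree less than d with d distinct roots is zero. *)
Lemma powers_inj (s : seq nat) h : uniq s -> size s = d ->
  (forall t, t \in s -> dot (powers t) h = 0) -> h = 0.
Proof.
move=> us ss H; pose p : {poly R} := \poly_(j < d) h (inord j) 0.
have pE t : p.[t%:R] = dot (powers t) h.
  rewrite horner_poly dotE; apply: eq_bigr => j _.
  by rewrite inord_val mxE mulrC.
have : p = 0.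
  apply: (@roots_geq_poly_eq0 _ p [seq t%:R | t <- s]).
  - by apply/allP => _ /mapP[t ts ->]; rewrite /root pE H.
  - by rewrite map_inj_uniq// => a b /eqP; rewrite eqr_nat => /eqP.
  - by rewrite size_map ss size_poly.
move=> p0; apply/colP => j; rewrite [RHS]mxE.
by have := congr1 (fun q : {poly R} => q`_j) p0; rewrite coef_poly ltn_ord inord_val coef0.
Qed.

(** Quantitative transversality of d hyperplanes: the inverse of the Vandermonde
    matrix is bounded, so the values at d nodes cannot all be small unless the
    polynomial is. *)
Lemma node_gap (s : seq nat) (rho : R) : uniq s -> size s = d -> 0 < rho ->
  exists2 c, 0 < c & forall h j, rho <= `|h j 0| ->
    exists2 t, t \in s & c <= `|dot (powers t) h|.
Proof.
move=> us ss rho0.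
pose V : 'M[R]_d := \matrix_(i, j) (nth 0%N s i)%:R ^+ j.
have Vh h i : (V *m h) i 0 = dot (powers (nth 0%N s i)) h.
  by rewrite mxE dotE; apply: eq_bigr => j _; rewrite !mxE.
have uV : V \in unitmx.
  apply: mulmx0_unit => h Vh0; apply: (powers_inj us ss) => t ts.
  have ti : (index t s < d)%N by rewrite -ss index_mem.
  have := Vh h (Ordinal ti); rewrite Vh0 mxE /= nth_index//.
have [K0 K0p HK] : exists2 K, 0 <= K & forall j, box K ((row j (invmx V))^T).
  exact: fin_box_bounded.
have q0 : 0 < d%:R * K0 + 1 by rewrite ltr_wpDl// mulr_ge0.
exists (rho / (d%:R * K0 + 1)) => [|h j hj]; first exact: divr_gt0.
apply: contrapT => H.
have Vhb : box (rho / (d%:R * K0 + 1)) (V *m h).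
  move=> i; rewrite Vh leNgt; apply/negP => lt0; apply: H.
  by exists (nth 0%N s i); [rewrite mem_nth// ss|exact: ltW].
have := dot_box (HK j) Vhb; rewrite dot_row mulKmx// => /(le_trans hj).
rewrite leNgt mulrA mulrCA gtr_pMr// ltr_pdivrMr// mul1r ltrDl ltr01//.
Qed.

End Nodes.

(** * Ridges, crossings and their heights *)

Section Bounds.
Variable R : realType.

Lemma dist_nat_ge1 (a b : nat) : a != b -> 1 <= `|a%:R - b%:R| :> R.
Proof.
wlog ab : a b / (a < b)%N => [W ne|_].
  case/orP: (leq_total a b) => ab; last rewrite distrC.
    by apply: W => //; rewrite ltn_neqAle ne.
  by apply: W; rewrite ?ltn_neqAle 1?eq_sym ?ne.
have e : b%:R - a%:R = (b - a)%N%:R :> R by rewrite natrB// ltnW.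
by rewrite distrC e normr_nat ler1n subn_gt0.
Qed.

Lemma prod_norm_ge1 (I : finType) (A : pred I) (F : I -> R) :
  (forall u : I, A u -> 1 <= `|F u|) -> 1 <= `|\prod_(u | A u) F u|.
Proof.
move=> H; elim/big_rec: _ => [|i x Ai hx]; first by rewrite normr1.
by rewrite normrM mulr_ege1// H.
Qed.

Lemma fin_lower_bound (I : finType) (c : I -> R) : (forall u : I, 0 < c u) ->
  exists2 c0, 0 < c0 & forall u, c0 <= c u.
Proof.
move=> c0; exists (\big[Num.min/1]_u c u) => [|i].
  by elim/big_ind: _ => // x y x0 y0; rewrite lt_min x0.
exact: bigmin_le_cond.
Qed.

End Bounds.

Section Peaks.
Variables (R : realType) (n k r : nat).
Local Notation d := n.+1.
Hypothesis r2 : (2 <= r)%N.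
Hypothesis rk : (r <= k)%N.
Hypothesis rd : (r <= d)%N.
Implicit Types (x y h : 'cV[R]_d) (S : {set 'I_k}) (i j : 'I_k).
Implicit Types (e : 'I_(d - r)).

(** The roots k, ..., k + d - r - 1 are common to all peaks and cut R^d down to
    dimension r. *)
Definition extra_poly : {poly R} := \prod_(e < d - r) ('X - ((k + e)%:R)%:P).

(** The exponent r / #|S| makes one formula cover both kinds of peak: for
    #|S| = 1 it is the centre of a ridge, with a root of multiplicity r, and for
    #|S| = r the crossing of r ridges, with simple roots. *)
Definition peak_poly S : {poly R} :=
  (\prod_(i in S) ('X - (i%:R)%:P)) ^+ (r %/ #|S|) * extra_poly.

Definition peak S : 'cV[R]_d := coefs n (peak_poly S).

Definition peak_set : {set {set 'I_k}} :=
  [set S : {set 'I_k} | #|S| == 1%N] :|: [set S : {set 'I_k} | #|S| == r].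

Lemma card_peak_set : #|peak_set| = (k + 'C(k, r))%N.
Proof.
rewrite cardsU !card_draws card_ord bin1 (_ : _ :&: _ = finset.set0) ?cards0 ?subn0//.
apply/setP => S; rewrite !inE; apply/negP => /andP[/eqP -> /eqP r1].
by move: r2; rewrite -r1.
Qed.

Lemma peak_card S : S \in peak_set -> (0 < #|S|)%N /\ (#|S| * (r %/ #|S|) = r)%N.
Proof.
rewrite !inE => /orP[]/eqP ->; first by rewrite divn1 mul1n.
have r0 : (0 < r)%N by exact: leq_trans r2.
by rewrite divnn r0 muln1.
Qed.

Lemma monic_extra : extra_poly \is monic.
Proof. by rewrite monic_prod// => i _; rewrite monicXsubC. Qed.

Lemma size_extra : size extra_poly = (d - r).+1.
Proof. by rewrite size_prod_XsubC [index_enum _]unlock -enumT size_enum_ord. Qed.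

Lemma monic_peak S : peak_poly S \is monic.
Proof.
by rewrite rpredM ?monic_extra// rpredX// monic_prod// => i _; rewrite monicXsubC.
Qed.

Lemma size_peak S : S \in peak_set -> size (peak_poly S) = d.+1.
Proof.
move=> /peak_card[_ e].
have mS : \prod_(i in S) ('X - (i%:R)%:P : {poly R}) \is monic.
  by rewrite monic_prod// => i _; rewrite monicXsubC.
have sS : size (\prod_(i in S) ('X - (i%:R)%:P : {poly R})) = #|S|.+1.
  by rewrite -big_enum size_prod_XsubC -cardE.
rewrite /peak_poly size_monicM ?monic_exp ?monic_neq0 ?monic_extra// size_extra.
have := size_exp (\prod_(i in S) ('X - (i%:R)%:P : {poly R})) (r %/ #|S|).
rewrite sS /= e.
have := monic_neq0 (monic_exp (r %/ #|S|) mS); rewrite -size_poly_gt0.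
by case: (size _) => //= m _ ->; rewrite addnS subnKC.
Qed.

Lemma value_peak S t : S \in peak_set -> value t (peak S) = (peak_poly S).[t%:R].
Proof. by move=> SP; rewrite value_coefs ?monic_peak ?size_peak. Qed.

Lemma value_peak_in S i : S \in peak_set -> i \in S -> value i (peak S) = 0.
Proof.
move=> SP iS; rewrite value_peak// hornerM horner_exp horner_prod (bigD1 i)//=.
rewrite hornerXsubC subrr mul0r expr0n.
have [s0 e] := peak_card SP.
case: (r %/ #|S|)%N e => [|m _]; last by rewrite mul0r.
by rewrite muln0 => r0; move: r2; rewrite -r0.
Qed.

Lemma value_peak_extra S e : S \in peak_set -> value (k + e) (peak S) = 0.
Proof.
move=> SP; rewrite value_peak// hornerM [X in _ * X]horner_prod (bigD1 e)//=.
by rewrite hornerXsubC subrr mul0r mulr0.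
Qed.

(** The value is a product of nonzero integers. *)
Lemma value_peak_out S i : S \in peak_set -> i \notin S ->
  1 <= `|value i (peak S)|.
Proof.
move=> SP iS; rewrite value_peak// hornerM horner_exp !horner_prod normrM normrX.
apply: mulr_ege1.
  apply: exprn_ege1; apply: prod_norm_ge1 => j jS; rewrite hornerXsubC.
  apply: dist_nat_ge1; apply: contraNneq iS => /val_inj ->//.
apply: prod_norm_ge1 => e _; rewrite hornerXsubC; apply: dist_nat_ge1.
by rewrite neq_ltn (leq_trans (ltn_ord i)) ?leq_addr.
Qed.

Lemma set1_peak i : [set i] \in peak_set.
Proof. by rewrite !inE cards1 eqxx. Qed.

Definition center i := peak [set i].

Definition rank1 (t : nat) : 'M[R]_d := powers R n t *m (powers R n t)^T.

(** The inverse covariance of ridge i: stiffness [kappa] across the hyperplanes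
    through its centre, [delta] in all directions. *)
Definition precision (delta kappa : R) i : 'M[R]_d :=
  delta%:M + kappa *: (rank1 i + \sum_(e < d - r) rank1 (k + e)).

Lemma dot_rank1 t h : dot h (rank1 t *m h) = dot (powers R n t) h ^+ 2.
Proof.
rewrite /rank1 -mulmxA /dot mulmxA mxE big_ord1 expr2.
by congr (_ * _); rewrite -[LHS]/(dot h (powers R n t)) dotC.
Qed.

Lemma dot_precision delta kappa i h :
  dot h (precision delta kappa i *m h) = delta * dot h h + kappa *
   (dot (powers R n i) h ^+ 2 + \sum_(e < d - r) dot (powers R n (k + e)) h ^+ 2).
Proof.
rewrite /precision mulmxDl dotDr mul_scalar_mx dotZr -scalemxAl dotZr.
rewrite mulmxDl dotDr dot_rank1 mulmx_suml dot_sumr.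
by congr (_ + _ * (_ + _)); apply: eq_bigr => e _; rewrite dot_rank1.
Qed.

Lemma coercive_precision delta kappa i : 0 <= kappa ->
  coercive delta (precision delta kappa i).
Proof.
move=> k0; split.
  rewrite /precision linearD /= tr_scalar_mx linearZ /= linearD /= linear_sum /=.
  have sr t : (rank1 t)^T = rank1 t by rewrite /rank1 trmx_mul trmxK.
  by rewrite sr; congr (_ + _ *: (_ + _)); apply: eq_bigr.
move=> h; rewrite dot_precision lerDl mulr_ge0// addr_ge0 ?sqr_ge0//.
by rewrite sumr_ge0// => e _; exact: sqr_ge0.
Qed.

Lemma dot_center i y : dot (powers R n i) (y - center i) = value i y.
Proof.
by rewrite (valueB _ (center i)) value_peak_in ?set1_peak ?inE// add0r.
Qed.

Lemma dot_center_extra i e y :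
  dot (powers R n (k + e)) (y - center i) = value (k + e) y.
Proof. by rewrite (valueB _ (center i)) value_peak_extra ?set1_peak// add0r. Qed.

Section Heights.
Variables delta kappa : R.
Hypothesis delta0 : 0 < delta.
Hypothesis kappa0 : 0 <= kappa.

Local Notation ridge i := (bump (center i) (precision delta kappa i)).

Lemma ridgeE i y : ridge i y = expR (- (1 / 2) *
  (delta * dot (y - center i) (y - center i) +
   kappa * (value i y ^+ 2 + \sum_(e < d - r) value (k + e) y ^+ 2))).
Proof.
rewrite /bump dot_precision dot_center; congr expR; congr (_ * (_ + _ * (_ + _))).
by apply: eq_bigr => e _; rewrite dot_center_extra.
Qed.

Lemma sum_extra_ge0 y : 0 <= \sum_(e < d - r) value (k + e) y ^+ 2.
Proof. by rewrite sumr_ge0// => e _; rewrite sqr_ge0. Qed.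

Lemma ridge_le_radial i y :
  ridge i y <= expR (- (1 / 2) * (delta * dot (y - center i) (y - center i))).
Proof.
rewrite ridgeE ler_expR !mulNr lerN2 ler_wpM2l ?divr_ge0// lerDl mulr_ge0//.
by rewrite addr_ge0 ?sum_extra_ge0 ?sqr_ge0.
Qed.

Lemma ridge_le1 i y : ridge i y <= 1.
Proof.
apply: le_trans (ridge_le_radial i y) _; rewrite -expR0 ler_expR mulNr oppr_le0.
by rewrite mulr_ge0 ?divr_ge0// mulr_ge0 ?dot_ge0// ltW.
Qed.

Lemma ridge_le_stiff i y (c : R) : 0 <= c ->
  c <= `|value i y| \/ (exists e, c <= `|value (k + e) y|) ->
  ridge i y <= expR (- (1 / 2) * (kappa * c ^+ 2)).
Proof.
move=> c0 H.
have sq (v : R) : c <= `|v| -> c ^+ 2 <= v ^+ 2.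
  by move=> cv; rewrite -[leRHS]real_normK ?num_real// lerXn2r// nnegrE.
rewrite ridgeE ler_expR !mulNr lerN2 ler_wpM2l ?divr_ge0//.
rewrite -[leLHS]add0r lerD ?mulr_ge0 ?dot_ge0 ?(ltW delta0)// ler_wpM2l//.
case: H => [/sq h|[e /sq h]].
  by rewrite (le_trans h)// lerDl sum_extra_ge0.
rewrite (le_trans h)// (bigD1 e)//= addrCA lerDl addr_ge0 ?sqr_ge0//.
by rewrite sumr_ge0// => e' _; rewrite sqr_ge0.
Qed.

(** On the ridge the steep terms vanish and only the weak curvature acts. *)
Lemma ridge_peak S i : S \in peak_set -> i \in S ->
  ridge i (peak S) =
  expR (- (1 / 2) * (delta * dot (peak S - center i) (peak S - center i))).
Proof.
move=> SP iS; rewrite ridgeE value_peak_in// expr0n add0r big1 ?mulr0 ?addr0//.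
by move=> e _; rewrite value_peak_extra// expr0n.
Qed.

End Heights.

Definition landscape delta kappa := bumps center (precision delta kappa).

Lemma landscape_le delta kappa y (A : {set 'I_k}) (u tau : R) :
  (forall i, bump (center i) (precision delta kappa i) y
             <= (if i \in A then u else 0) + tau) ->
  landscape delta kappa y <= #|A|%:R * u + k%:R * tau.
Proof.
move=> H; apply: (@le_trans _ _ (\sum_(i < k) ((if i \in A then u else 0) + tau))).
  by apply: ler_sum => i _; exact: H.
rewrite big_split /= sumr_const card_ord -big_mkcond /= sumr_const.
by rewrite !mulr_natl.
Qed.

Lemma powers_bound : exists2 L, 0 < L &
  forall i s h, box s h -> 0 <= s -> `|dot (powers R n i) h| <= L * s.
Proof.
have [K K0 HK] := fin_box_bounded (fun i => powers R n i).
exists (d%:R * K + 1); first by rewrite ltr_wpDl// mulr_ge0.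
move=> i s h hs s0; rewrite (le_trans (dot_box (HK i) hs))//.
by rewrite mulrA ler_wpM2r// lerDl.
Qed.

(** Leaving the crossing of r ridges means leaving one of them, or one of the
    hyperplanes common to all, by a definite amount. *)
Lemma crossing_gap (rho : R) : 0 < rho -> exists2 c, 0 < c &
  forall S h l, #|S| = r -> rho <= `|h l 0| ->
    (exists2 i, i \in S & c <= `|dot (powers R n i) h|) \/
    (exists e, c <= `|dot (powers R n (k + e)) h|).
Proof.
move=> rho0.
suff /fin_all_exists2[c c0 Hc] : forall S, exists2 c, 0 < c &
  forall h l, #|S| = r -> rho <= `|h l 0| ->
    (exists2 i, i \in S & c <= `|dot (powers R n i) h|) \/
    (exists e, c <= `|dot (powers R n (k + e)) h|).
  have [c1 c10 H1] := fin_lower_bound c0; exists c1 => // S h l Sr hl.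
  have [[i iS h1]|[e h1]] := Hc S h l Sr hl.
    by left; exists i => //; exact: le_trans (H1 S) h1.
  by right; exists e; exact: le_trans (H1 S) h1.
move=> S; have [Sr|Sr] := eqVneq #|S| r; last first.
  by exists 1 => // h l /eqP; rewrite (negbTE Sr).
pose s := [seq val i | i <- enum S] ++ [seq (k + val e)%N | e <- enum 'I_(d - r)].
have us : uniq s.
  have ki : injective (fun e => k + val e)%N by move=> e e' /addnI /val_inj.
  rewrite cat_uniq (map_inj_uniq val_inj) (map_inj_uniq ki) !enum_uniq andbT.
  apply/hasPn => _ /mapP[e _ ->]; apply/negP => /mapP[i _ /= ke].
  by have := ltn_ord i; rewrite -ke ltnNge leq_addr.
have ss : size s = d.
  by rewrite size_cat !size_map -enumT size_enum_ord -cardE Sr subnKC.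
have [c c0 Hc] := node_gap us ss rho0.
exists c => // h l _ /Hc[t ts ct].
move: ts; rewrite mem_cat => /orP[]/mapP[a aS ta]; rewrite ta in ct.
  by left; exists a => //; rewrite -mem_enum.
by right; exists a.
Qed.

(** Order of the choices: [rho] keeps the cubes away from the other ridges;
    [delta] makes the r ridges at a crossing lose at most 1/4 in total; [omega]
    is at most half of what the curvature [delta] makes a single ridge lose at
    distance [rho], and [kappa] brings the total height of everything off the
    ridges below [omega].  The first property of the cubes
    makes them disjoint, since a point of the cube around [peak S] determines
    S. *)
Lemma landscape_peaks : exists delta kappa rho omega : R,
  [/\ 0 < delta, 0 < kappa, 0 < rho & 0 < omega] /\
  (forall S z i, S \in peak_set -> box rho (z - peak S) ->
     (i \in S) = (`|value i z| < 1 / 2)) /\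
  (forall S y l, S \in peak_set -> box rho (y - peak S) ->
     `|(y - peak S) l 0| = rho ->
     landscape delta kappa y + omega <= landscape delta kappa (peak S)).
Proof.
have [L L0 HL] := powers_bound.
pose rho := 1 / (4 * L).
have rho0 : 0 < rho by rewrite divr_gt0// mulr_gt0.
have Lrho : L * rho = 1 / 4 by rewrite /rho; field; rewrite gt_eqF.
have [c1 c10 gap] := crossing_gap rho0.
pose c := Num.min c1 (1 / 4).
have c0 : 0 < c by rewrite lt_min c10 divr_gt0.
have cc1 : c <= c1 by rewrite ge_min lexx.
have c4 : c <= 1 / 4 by rewrite ge_min lexx orbT.
have near S z i : S \in peak_set -> box rho (z - peak S) ->
    (i \in S -> `|value i z| <= 1 / 4) /\ (i \notin S -> 3 / 4 <= `|value i z|).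
  move=> SP zS; have := HL i _ _ zS (ltW rho0); rewrite Lrho => h.
  rewrite (valueB _ (peak S)); split=> [iS|iS].
    by rewrite value_peak_in// add0r.
  have h1 := value_peak_out SP iS.
  have := lerB_normD (value i (peak S)) (dot (powers R n i) (z - peak S)); lra.
pose Dist := \sum_(S : {set 'I_k}) \sum_i dot (peak S - center i) (peak S - center i).
have dist_le S i : dot (peak S - center i) (peak S - center i) <= Dist.
  rewrite /Dist (bigD1 S)//= (bigD1 i)//= -addrA lerDl addr_ge0//.
    by rewrite sumr_ge0// => j _; exact: dot_ge0.
  by rewrite sumr_ge0// => T _; rewrite sumr_ge0// => j _; exact: dot_ge0.
have Dist0 : 0 <= Dist.
  by rewrite /Dist sumr_ge0// => T _; rewrite sumr_ge0// => j _; exact: dot_ge0.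
have rR : 0 < r%:R :> R by rewrite ltr0n (leq_trans _ r2).
have kR : 0 < k%:R :> R by rewrite ltr0n (leq_trans _ rk)// (leq_trans _ r2).
pose delta := 1 / (2 * (r%:R * Dist + 1)).
have rD : 0 <= r%:R * Dist by rewrite mulr_ge0// ltW.
have delta0 : 0 < delta by rewrite divr_gt0// mulr_gt0//; lra.
have rdD : r%:R * (1 / 2 * (delta * Dist)) <= 1 / 4.
  have -> : r%:R * (1 / 2 * (delta * Dist)) = 1 / 4 * (r%:R * Dist / (r%:R * Dist + 1)).
    by rewrite /delta; field; lra.
  by rewrite ler_piMr ?divr_ge0// ler_pdivrMr; lra.
pose E := expR (- (1 / 2) * (delta * rho ^+ 2)).
have E1 : E < 1.
  by rewrite expR_lt1 mulNr oppr_lt0 mulr_gt0 ?divr_gt0// mulr_gt0// exprn_gt0.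
pose omega := Num.min (1 / 4) ((1 - E) / 2).
have omega0 : 0 < omega by rewrite lt_min !divr_gt0//; lra.
have o4 : omega <= 1 / 4 by rewrite ge_min lexx.
have oE : omega <= (1 - E) / 2 by rewrite ge_min lexx orbT.
pose kappa := 2 * (k%:R / omega) / c ^+ 2.
have kappa0 : 0 < kappa by rewrite divr_gt0 ?exprn_gt0// mulr_gt0// divr_gt0.
pose tau := expR (- (1 / 2) * (kappa * c ^+ 2)).
have ktau : k%:R * tau <= omega.
  have -> : tau = (expR (k%:R / omega))^-1.
    rewrite -expRN; congr expR; rewrite /kappa; field.
    by rewrite !gt_eqF.
  rewrite ler_pdivrMr ?expR_gt0//.
  have := expR_ge1Dx (k%:R / omega); rewrite -(ler_pM2l omega0) mulrDr.
  have -> : omega * (k%:R / omega) = k%:R by field; rewrite gt_eqF.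
  lra.
have tau0 : 0 <= tau by exact: expR_ge0.
exists delta, kappa, rho, omega; split; first by split.
split=> [S z i SP zS|S y l SP yS yl].
  have [h1 h2] := near S z i SP zS.
  by have [iS|iS] := boolP (i \in S); [have := h1 iS|have := h2 iS];
     case: ltP => //; lra.
have stiff i : c <= `|value i y| \/ (exists e, c <= `|value (k + e) y|) ->
    bump (center i) (precision delta kappa i) y <= tau.
  exact: ridge_le_stiff (ltW kappa0) _ _ _ (ltW c0).
have off i : i \notin S -> bump (center i) (precision delta kappa i) y <= tau.
  by move=> iS; apply: stiff; left; have := (near S y i SP yS).2 iS; lra.
have ridge1 i : bump (center i) (precision delta kappa i) y <= 1.
  exact: ridge_le1 (ltW kappa0) _ _.
have lower : \sum_(i in S)
    bump (center i) (precision delta kappa i) (peak S) <= landscape delta kappa (peak S).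
  rewrite /landscape /bumps [leRHS](bigID (mem S))/= lerDl sumr_ge0// => i _.
  exact/ltW/bump_gt0.
(* First the centre of a single ridge, then a crossing of r ridges. *)
have := SP; rewrite !inE => /orP[/cards1P[i Si]|/eqP Sr].
  rewrite -lerBrDr; apply: (@le_trans _ _ (#|S|%:R * E + k%:R * tau)).
    apply: landscape_le => j; have [jS|/off] := boolP (j \in S); last by rewrite add0r.
    have /eqP ji : j == i by move: jS; rewrite Si inE.
    apply: le_trans (ridge_le_radial delta (ltW kappa0) j y) _.
    apply: (@le_trans _ _ E); last by rewrite lerDl.
    rewrite ler_expR !mulNr lerN2 ler_wpM2l ?divr_ge0// ler_wpM2l ?(ltW delta0)//.
    have -> : center j = peak S by rewrite Si ji.
    rewrite -yl real_normK ?num_real// dotE (bigD1 l)//= -expr2 lerDl sumr_ge0//.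
    by move=> q _; rewrite -expr2 sqr_ge0.
  move: lower; rewrite (eq_bigr (fun=> 1)) => [|j jS].
    by rewrite sumr_const Si cards1 mul1r; lra.
  rewrite ridge_peak//; move: jS; rewrite {1}Si inE => /eqP ->.
  by rewrite Si subrr dot0l !mulr0 expR0.
(* At y some ridge i of S is at most tau, so at most r - 1 ridges remain. *)
have [i iS Hi] : exists2 i, i \in S & forall j,
    bump (center j) (precision delta kappa j) y
    <= (if j \in S :\ i then 1 else 0) + tau.
  have hl : rho <= `|(y - peak S) l 0| by rewrite yl.
  have [[i iS]|[e]] := gap S _ _ Sr hl.
    have -> : dot (powers R n i) (y - peak S) = value i y.
      by rewrite (valueB _ (peak S) y) value_peak_in// add0r.
    move=> ci.
    exists i => // j; rewrite !inE; have [->|ji] /= := eqVneq j i.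
      by rewrite add0r; apply: stiff; left; exact: le_trans ci.
    have [jS|/off] := boolP (j \in S); last by rewrite add0r.
    by rewrite (le_trans (ridge1 j))// lerDl.
  have -> : dot (powers R n (k + e)) (y - peak S) = value (k + e) y.
    by rewrite (valueB _ (peak S) y) value_peak_extra// add0r.
  move=> ce.
  have [i iS] : exists i, i \in S by apply/card_gt0P; rewrite Sr (leq_trans _ r2).
  exists i => // j; apply: (@le_trans _ _ tau).
    by apply: stiff; right; exists e; exact: le_trans ce.
  by rewrite lerDr; case: ifP.
have := landscape_le Hi; rewrite (cardsD1 i) iS in Sr; rewrite mulr1 => up.
have Sr' : r%:R = 1 + #|S :\ i|%:R :> R by rewrite -Sr natrD.
have low : r%:R - 1 / 4 <= landscape delta kappa (peak S).
  apply: le_trans lower; apply: (@le_trans _ _ (\sum_(i in S) (1 - 1 / 2 * (delta * Dist)))).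
    rewrite sumr_const (cardsD1 i) iS Sr mulrnBl -[X in _ <= _ - X]mulr_natl; lra.
  apply: ler_sum => j jS; rewrite ridge_peak//.
  apply: le_trans (expR_ge1Dx _); rewrite lerD2l mulNr lerN2 ler_wpM2l ?divr_ge0//.
  by rewrite ler_wpM2l// ltW.
lra.
Qed.

(** A tilt that varies by at most a factor exp(2 s) over the cubes, with
    2 s k < omega, leaves each peak higher than the boundary of its cube. *)
Lemma tilted_peaks : exists Phi : 'cV[R]_d -> R,
  [/\ is_gaussian_mixture k Phi, finite_set (modes Phi) &
    exists2 z : {set 'I_k} -> 'cV[R]_d, {in peak_set &, injective z} &
      forall S, S \in peak_set -> modes Phi (z S)].
Proof.
have [delta [kappa [rho [omega [[delta0 kappa0 rho0 omega0] [sep gap]]]]]] :=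
  landscape_peaks.
have coP i := coercive_precision delta i (ltW kappa0).
have k0 : (0 < k)%N by rewrite (leq_trans _ rk)// (leq_trans _ r2).
pose i0 : 'I_k := Ordinal k0.
have [b b0 Hb] : exists2 b, 0 <= b & forall S, box b (peak S).
  exact: fin_box_bounded.
pose s := omega / (2 * k.+1%:R).
have s0 : 0 < s by rewrite divr_gt0// mulr_gt0.
pose eta := s / (d%:R * (b + rho)).
have eta0 : 0 < eta by rewrite divr_gt0// mulr_gt0//; lra.
have [a a_eta fin] := generic_tilt_finite_modes center i0 delta0 coP eta0.
have [Z Z0 mix] := tilted_mixture center i0 delta0 coP a.
exists (fun x => Z * tilted center (precision delta kappa) a x).
rewrite modesZ//; split=> //.
have tilt_le x : box (b + rho) x -> `|dot a x| <= s.
  move=> /(dot_box a_eta) /le_trans; apply.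
  rewrite /eta le_eqVlt; apply/orP; left; apply/eqP; field.
  by rewrite !gt_eqF//; lra.
have land_le x : landscape delta kappa x <= k%:R.
  rewrite -[k in leRHS]card_ord -sumr_const; apply: ler_sum => i _.
  exact: ridge_le1 (ltW kappa0) _ _.
have /choice[z Hz] : forall S, exists z, S \in peak_set ->
    box rho (z - peak S) /\ modes (tilted center (precision delta kappa) a) z.
  move=> S; have [SP|_] := boolP (S \in peak_set); last by exists 0.
  have [z z1 z2] : exists2 z, box rho (z - peak S) &
      modes (tilted center (precision delta kappa) a) z.
    apply: (@interior_mode _ _ _ _ _ _ _ rho0).
      exact: c11M (c11_bumps center coP) (c11_expR (c11_dot a)).
    move=> y l yS yl; have := gap S y l SP yS yl; rewrite /tilted.
    rewrite -/(landscape _ _); set v := landscape _ _ (peak S); set u := landscape _ _ y.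
    move=> uv.
    have yb : box (b + rho) y.
      have -> : y = peak S - (peak S - y) by rewrite opprB addrC subrK.
      by apply: boxB => //; rewrite -opprB; exact: boxN.
    have pb : box (b + rho) (peak S) by apply: box_le (Hb S); lra.
    have := tilt_le y yb; have := tilt_le _ pb; rewrite !ler_norml.
    move=> /andP[p1 _] /andP[_ y1].
    have vk : v <= k%:R by exact: land_le.
    have v0 : 0 < v by exact: (bumps_gt0 _ _ i0).
    apply: (@le_lt_trans _ _ ((v - omega) * expR s)).
      apply: ler_pM; rewrite ?expR_ge0 ?ler_expR//; last lra.
      exact/ltW/(bumps_gt0 _ _ i0).
    apply: (@lt_le_trans _ _ (v * expR (- s))); last first.
      by rewrite ler_wpM2l ?ler_expR ?(ltW v0).
    have -> : expR (- s) = expR s * expR (- (2 * s)) by rewrite -expRD; congr expR; ring.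
    rewrite mulrCA mulrC ltr_pM2l ?expR_gt0//.
    have h1 := expR_ge1Dx (- (2 * s)).
    apply: (@lt_le_trans _ _ (v * (1 + - (2 * s)))); last by rewrite ler_wpM2l// ltW.
    have : v * (2 * s) < omega.
      apply: (@le_lt_trans _ _ (k%:R * (2 * s))); first by rewrite ler_wpM2r//; lra.
      have -> : k%:R * (2 * s) = omega * (k%:R / k.+1%:R).
        by rewrite /s; field; rewrite addrC natr1 pnatr_eq0.
      by rewrite gtr_pMr// ltr_pdivrMr// mul1r ltr_nat.
    lra.
  by exists z.
exists z => [S T SP TP e|S SP]; last by have [] := Hz S SP.
apply/setP => i; have [hS _] := Hz S SP; have [hT _] := Hz T TP.
by rewrite (sep S (z S) i SP hS) (sep T (z T) i TP hT) e.
Qed.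

Lemma max_modes_ge : (((k + 'C(k, r))%N%:R)%:E <= max_modes R d k)%E.
Proof.
have [Phi [mix fin [z zinj zP]]] := tilted_peaks.
apply: le_trans (ereal_sup_ubound _); last by exists Phi.
rewrite lee_fin ler_nat -card_peak_set cardE -(size_map z).
apply: uniq_leq_size => [|_ /mapP[S SP ->]].
  rewrite map_inj_in_uniq ?enum_uniq// => S T SP TP.
  by apply: zinj; rewrite -mem_enum.
by rewrite in_fset_set// inE; apply: zP; rewrite -mem_enum.
Qed.

End Peaks.

(** * The lower bounds *)

Theorem corollary4p2 (R : realType) :
  (forall d k : nat, (2 <= d)%N -> (2 <= k)%N ->
     (((L_bin d k)%:R)%:E <= max_modes R d k)%E) /\
  (forall d k : nat, (4 <= k)%N -> (k %/ 2 <= d)%N ->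
     (((k + 'C(k, k %/ 2))%N%:R)%:E <= max_modes R d k)%E).
Proof.
have ge d k r : (2 <= r)%N -> (r <= k)%N -> (r <= d)%N ->
    (((k + 'C(k, r))%N%:R)%:E <= max_modes R d k)%E.
  by case: d => [|n] r2 rk rd; [case: r r2 rk rd | exact: max_modes_ge].
split=> d k h1 h2; last first.
  have k2 : (2 <= k %/ 2)%N by rewrite leq_divRL.
  by apply: ge => //; exact: leq_div.
(* The default value 0 of the maximum is covered by r = 2. *)
rewrite /L_bin big_seq.
elim/big_ind: _ => [|a b ha hb|r].
- apply: le_trans (ge d k 2%N (leqnn 2) h2 h1).
  by rewrite lee_fin ler_nat leq_add2l.
- by rewrite /maxn; case: ifP.
- rewrite mem_index_iota ltnS leq_min => /and3P[r2 rd rk]; exact: ge.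
Qed.
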